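(* Let $\Sigma$ be a finite alphabet and let $L\subseteq\Sigma^*$ be a language. Then: - $\mathcal H_L$ is bounded; - $\|\mathcal H_L\|\leq 1$; - for every $u\in\Sigma^*$, $\mathcal H_Le_u=\mathbf 1_{u^{-1}L}$; - $\overline{\operatorname{ran}\mathcal H_L}=X_L$.
   Context: All Banach spaces are real. $\Sigma$ is a finite nonempty alphabet, $\Sigma^*$ the free monoid of finite words over $\Sigma$; $u^{-1}L=\{v\in\Sigma^*:uv\in L\}$; $\mathbf 1_B$ is the characteristic function of $B$. $\ell_1(\Sigma^* )$ is the space of absolutely summable real families $a=(a(u))_{u\in\Sigma^*}$ with norm $\|a\|_1=\sum_u|a(u)|$, with standard unit vectors $e_u$; $\ell_\infty(\Sigma^* )$ is the space of bounded real functions on $\Sigma^*$ with the supremum norm. $X_L=\overline{\operatorname{span}}\{\mathbf 1_{u^{-1}L}:u\in\Sigma^*\}\subset\ell_\infty(\Sigma^* )$ (norm closure). The language Hankel operator is the linear operator $\mathcal H_L:\ell_1(\Sigma^* )\to\ell_\infty(\Sigma^* )$ defined by $(\mathcal H_La)(v)=\sum_{u\in\Sigma^*}a(u)\mathbf 1_L(uv)$ for $v\in\Sigma^*$ (an absolutely convergent series). $\operatorname{ran}$ denotes the range, and its closure is taken in $\ell_\infty(\Sigma^* )$. *)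

(* Defs.v *)
From HB Require Import structures.
From mathcomp Require Import all_boot all_order all_algebra.
From mathcomp Require Import all_classical all_reals all_analysis.

Set Implicit Arguments.
Unset Strict Implicit.
Unset Printing Implicit Defensive.

Import Order.TTheory GRing.Theory Num.Theory.
Import numFieldNormedType.Exports.

Local Open Scope classical_set_scope.
Local Open Scope ring_scope.

Section summable_sum.
Context {R : realType} {I : choiceType}.
Implicit Types f g : I -> R.

Definition summable_family f : bool := summable setT (EFin \o f).

(* The sum of an absolutely summable real family, as the difference of the
   sums of its positive and negative parts (junk value if not summable). *)
Definition rsum f : R :=
  fine (\esum_(i in setT) ((EFin \o f)^\+ i)%E) -
  fine (\esum_(i in setT) ((EFin \o f)^\- i)%E).

Definition l1norm f : R := fine (\esum_(i in setT) (`|f i|%:E)%E).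

Lemma summable_familyE f :
  summable_family f = (\esum_(i in setT) (`|f i|%:E) < +oo)%E.
Proof. by []. Qed.

Lemma l1normE f : summable_family f ->
  ((l1norm f)%:E = \esum_(i in setT) (`|f i|%:E))%E.
Proof. by move=> sf; rewrite /l1norm fineK //; move: sf; rewrite /summable_family summableE. Qed.

Lemma l1norm_ge0 f : 0 <= l1norm f.
Proof. by apply: fine_ge0; apply: esum_ge0 => i _; rewrite lee_fin. Qed.

Lemma summable_family_le f g : (forall i, `|f i| <= `|g i|) ->
  summable_family g -> summable_family f.
Proof.
move=> fg; rewrite !summable_familyE; apply: le_lt_trans.
by apply: le_esum => i _; rewrite lee_fin.
Qed.

Lemma l1norm_le f g : (forall i, `|f i| <= `|g i|) ->
  summable_family g -> l1norm f <= l1norm g.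
Proof.
move=> fg sg; rewrite -lee_fin !l1normE //; last exact: summable_family_le fg sg.
by apply: le_esum => i _; rewrite lee_fin.
Qed.

Lemma summable_familyD f g : summable_family f -> summable_family g ->
  summable_family (f + g).
Proof. exact: summableD. Qed.

Lemma l1normD_ge0 f g : (forall i, 0 <= f i) -> (forall i, 0 <= g i) ->
  summable_family f -> summable_family g ->
  l1norm (f + g) = l1norm f + l1norm g.
Proof.
move=> f0 g0 sf sg; apply: EFin_inj; rewrite EFinD !l1normE //; last first.
  exact: summable_familyD.
rewrite -esumD //; apply: eq_esum => i _.
by rewrite -EFinD !ger0_norm ?addr_ge0.
Qed.

Lemma l1normD f g : summable_family f -> summable_family g ->
  l1norm (f + g) <= l1norm f + l1norm g.
Proof.
move=> sf sg; rewrite -lee_fin EFinD !l1normE //; last exact: summable_familyD.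
rewrite -esumD //; apply: le_esum => i _.
by rewrite -EFinD lee_fin; exact: ler_normD.
Qed.

Lemma esumZ (c : R) f :
  (\esum_(i in setT) (`|(c *: f) i|%:E) =
   `|c|%:E * \esum_(i in setT) (`|f i|%:E))%E.
Proof.
rewrite /esum -ereal_supZl //; last first.
  by apply/set0P; exists 0%E, set0; [exact: fsets_set0|rewrite fsbig_set0].
congr ereal_sup; rewrite image_comp; apply: eq_imagel => A [finA _] /=.
rewrite ge0_mule_fsumr //; apply: eq_fsbigr => i _.
by rewrite -EFinM -normrM.
Qed.

Lemma summable_familyZ (c : R) f : summable_family f -> summable_family (c *: f).
Proof.
by rewrite !summable_familyE esumZ => sf; rewrite lte_mul_pinfty // lee_fin.
Qed.

Lemma l1normZ (c : R) f : summable_family f -> l1norm (c *: f) = `|c| * l1norm f.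
Proof.
move=> sf; apply: EFin_inj; rewrite EFinM !l1normE ?esumZ //.
exact: summable_familyZ.
Qed.

Lemma l1norm_eq0 f : summable_family f -> l1norm f = 0 -> f = 0.
Proof.
move=> sf f0; apply/funext => i; apply/eqP; rewrite -normr_le0 -lee_fin.
rewrite -[in leRHS]f0 l1normE //; apply: esum_ge; exists [set i].
  by split.
by rewrite fsbig_set1.
Qed.

Lemma rsum_posneg f g h : (forall i, 0 <= g i) -> (forall i, 0 <= h i) ->
  summable_family g -> summable_family h -> f = g - h ->
  rsum f = l1norm g - l1norm h.
Proof.
move=> g0 h0 sg sh ->.
have sgh : summable_family (g - h) by exact: (summableB sg sh).
have finp : (\esum_(i in setT) ((EFin \o (g - h)%R)^\+ i))%E \is a fin_num.
  have := summable_funepos sgh; rewrite summableE.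
  by under eq_esum do rewrite gee0_abs ?funepos_ge0 //.
have finn : (\esum_(i in setT) ((EFin \o (g - h)%R)^\- i))%E \is a fin_num.
  have := summable_funeneg sgh; rewrite summableE.
  by under eq_esum do rewrite gee0_abs ?funeneg_ge0 //.
apply: EFin_inj; rewrite /rsum !EFinB (l1normE sg) (l1normE sh) !fineK //.
have -> : EFin \o (g - h) = ((EFin \o g) \- (EFin \o h))%E by [].
rewrite (@esumB _ _ setT (EFin \o g) (EFin \o h)) //; last 2 first.
- by move=> i _; rewrite /= lee_fin.
- by move=> i _; rewrite /= lee_fin.
by congr (_ - _)%E; apply: eq_esum => i _ /=; rewrite ger0_norm.
Qed.

Let pos f : I -> R := fun i => Num.max (f i) 0.
Let neg f : I -> R := fun i => Num.max (- f i) 0.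

Let pos_ge0 f i : 0 <= pos f i. Proof. by rewrite /pos le_max lexx orbT. Qed.
Let neg_ge0 f i : 0 <= neg f i. Proof. by rewrite /neg le_max lexx orbT. Qed.

Let pos_le f i : `|pos f i| <= `|f i|.
Proof. by rewrite ger0_norm // /pos ge_max ler_norm normr_ge0. Qed.

Let neg_le f i : `|neg f i| <= `|f i|.
Proof. by rewrite ger0_norm // /neg ge_max -normrN ler_norm normr_ge0. Qed.

Let posneg f : f = pos f - neg f.
Proof.
apply/funext => i; rewrite -[RHS]/(pos f i - neg f i) /pos /neg.
have [f0|f0] := leP 0 (f i).
  by rewrite max_r ?subr0 // oppr_le0.
by rewrite max_l ?sub0r ?opprK // oppr_ge0 ltW.
Qed.

Let spos f : summable_family f -> summable_family (pos f).
Proof. by apply: summable_family_le => i; exact: pos_le. Qed.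

Let sneg f : summable_family f -> summable_family (neg f).
Proof. by apply: summable_family_le => i; exact: neg_le. Qed.

Lemma rsumD f g : summable_family f -> summable_family g ->
  rsum (f + g) = rsum f + rsum g.
Proof.
move=> sf sg.
rewrite (@rsum_posneg (f + g) (pos f + pos g) (neg f + neg g)).
- rewrite !l1normD_ge0 //; try exact: spos; try exact: sneg.
  rewrite (@rsum_posneg f (pos f) (neg f)) //; try exact: spos; try exact: sneg.
  rewrite (@rsum_posneg g (pos g) (neg g)) //; try exact: spos; try exact: sneg.
  by rewrite opprD addrACA.
- by move=> i; exact: addr_ge0.
- by move=> i; exact: addr_ge0.
- by apply: summable_familyD; exact: spos.
- by apply: summable_familyD; exact: sneg.
- by rewrite opprD addrACA -!posneg.
Qed.

Lemma rsumZ (c : R) f : summable_family f -> rsum (c *: f) = c * rsum f.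
Proof.
move=> sf.
rewrite (@rsum_posneg f (pos f) (neg f)) //; try exact: spos; try exact: sneg.
have [c0|c0] := leP 0 c.
  rewrite (@rsum_posneg (c *: f) (c *: pos f) (c *: neg f)).
  - rewrite !l1normZ ?ger0_norm ?mulrBr //; [exact: sneg|exact: spos].
  - by move=> i; exact: mulr_ge0.
  - by move=> i; exact: mulr_ge0.
  - by apply: summable_familyZ; exact: spos.
  - by apply: summable_familyZ; exact: sneg.
  - by rewrite -scalerBr -posneg.
have c0' : 0 <= - c by rewrite oppr_ge0 ltW.
rewrite (@rsum_posneg (c *: f) ((- c) *: neg f) ((- c) *: pos f)).
- rewrite !l1normZ; [|exact: spos|exact: sneg].
  by rewrite ger0_norm // -mulrBr mulNr -mulrN opprB.
- by move=> i; exact: mulr_ge0.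
- by move=> i; exact: mulr_ge0.
- by apply: summable_familyZ; exact: sneg.
- by apply: summable_familyZ; exact: spos.
- by rewrite -scalerBr scaleNr -scalerN opprB -posneg.
Qed.

Lemma rsum_le f : summable_family f -> `|rsum f| <= l1norm f.
Proof.
move=> sf.
rewrite (@rsum_posneg f (pos f) (neg f)) //; try exact: spos; try exact: sneg.
have -> : l1norm f = l1norm (pos f) + l1norm (neg f).
  rewrite -l1normD_ge0 //; try exact: spos; try exact: sneg.
  rewrite /l1norm; congr fine; apply: eq_esum => i _; congr EFin.
  rewrite -[(pos f + neg f) i]/(pos f i + neg f i).
  rewrite [RHS]ger0_norm ?addr_ge0 // /pos /neg.
  have [f0|f0] := leP 0 (f i).
    by rewrite max_r ?addr0 ?ger0_norm ?oppr_le0.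
  by rewrite max_l ?add0r ?ltr0_norm ?oppr_ge0 // ltW.
by rewrite (le_trans (ler_normB _ _)) // !ger0_norm ?l1norm_ge0.
Qed.

End summable_sum.

Section ell1.
Context (R : realType) (I : choiceType).

Definition ell1_pred : {pred (I -> R)} := fun f => summable_family f.

Record ell1 : Type := Ell1 { ell1_fun :> I -> R; ell1P : ell1_fun \in ell1_pred }.

HB.instance Definition _ := [isSub for ell1_fun].
HB.instance Definition _ := [Choice of ell1 by <:].

Lemma ell1_submod_closed : submod_closed ell1_pred.
Proof.
split.
  rewrite unfold_in /= summable_familyE esum1 // => i _.
  by rewrite -[(0 : I -> R) i]/0 normr0.
by move=> c f g sf sg; apply: summable_familyD sg; exact: summable_familyZ.
Qed.

HB.instance Definition _ :=
  GRing.isSubmodClosed.Build R (I -> R) ell1_pred ell1_submod_closed.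
HB.instance Definition _ := [SubChoice_isSubLmodule of ell1 by <:].

Let norm (a : ell1) : R := l1norm a.

Let ler_normD (a b : ell1) : norm (a + b) <= norm a + norm b.
Proof. by apply: l1normD; exact: ell1P. Qed.

Let normrZ (c : R) (a : ell1) : norm (c *: a) = `|c| * norm a.
Proof. by apply: l1normZ; exact: ell1P. Qed.

Let normr0_eq0 (a : ell1) : norm a = 0 -> a = 0.
Proof. by move=> /(l1norm_eq0 (ell1P a)) a0; apply: val_inj. Qed.

HB.instance Definition _ :=
  Lmodule_isNormed.Build R ell1 ler_normD normrZ normr0_eq0.

Lemma ell1_normE (a : ell1) : `|a| = fine (\esum_(i in setT) (`|a i|%:E)%E).
Proof. by []. Qed.

Lemma ell1_unit_subproof (i : I) : (\1_[set i] : I -> R) \in ell1_pred.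
Proof.
rewrite unfold_in /= summable_familyE.
have -> : (\esum_(j in setT) (`|(\1_[set i] : I -> R) j|%:E))%E = 1%E.
  rewrite (eq_esum (b := fun j => if j \in [set i] then 1%E else 0%E)); last first.
    by move=> j _; rewrite indicE; case: (j \in _); rewrite ?normr1 ?normr0.
  by rewrite -esum_mkcond esum_set1.
by rewrite ltry.
Qed.

Definition ell1_unit (i : I) : ell1 := Ell1 (ell1_unit_subproof i).

End ell1.

Section ellinf.
Context (R : realType) (I : choiceType).

Definition ellinf_pred : {pred (I -> R)} := mem [set f : I -> R | bounded_fun f].

Record ellinf : Type :=
  Ellinf { ellinf_fun :> I -> R; ellinfP : ellinf_fun \in ellinf_pred }.

HB.instance Definition _ := [isSub for ellinf_fun].
HB.instance Definition _ := [Choice of ellinf by <:].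

Lemma ellinf_predP (f : I -> R) :
  f \in ellinf_pred <-> exists M, forall i, `|f i| <= M.
Proof.
rewrite inE; split=> [[M0 [_ fM]]|[M fM]].
  by exists (M0 + 1) => i; apply: fM => //; rewrite ltrDl.
exists M; split => [|M' MM' i _]; first exact: num_real.
exact: le_trans (fM i) (ltW MM').
Qed.

Lemma ellinf_submod_closed : submod_closed ellinf_pred.
Proof.
split; first by apply/ellinf_predP; exists 0 => i; rewrite normr0.
move=> c f g /ellinf_predP[M fM] /ellinf_predP[N gN].
apply/ellinf_predP; exists (`|c| * M + N) => i.
rewrite (le_trans (ler_normD _ _)) // lerD //.
by rewrite [leLHS]normrM ler_wpM2l.
Qed.

HB.instance Definition _ :=
  GRing.isSubmodClosed.Build R (I -> R) ellinf_pred ellinf_submod_closed.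
HB.instance Definition _ := [SubChoice_isSubLmodule of ellinf by <:].

Let norm (b : ellinf) : R := sup (range (fun i => `|b i|)).

Let norm_ub (b : ellinf) i : `|b i| <= norm b.
Proof.
apply: ub_le_sup; last by exists i.
by have /ellinf_predP[M bM] := ellinfP b; exists M => _ [j _ <-].
Qed.

Let norm_ge0 (b : ellinf) : 0 <= norm b.
Proof.
have [[i _]|/set0P/negP/negPn/eqP I0] := pselect ([set: I] !=set0).
  exact: le_trans (norm_ub b i).
by rewrite /norm I0 image_set0 sup0.
Qed.

Let norm_le (b : ellinf) (M : R) : 0 <= M -> (forall i, `|b i| <= M) ->
  norm b <= M.
Proof.
move=> M0 bM.
have [[i _]|/set0P/negP/negPn/eqP I0] := pselect ([set: I] !=set0).
  by apply: ge_sup; [exists `|b i|, i|move=> _ [j _ <-]].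
by rewrite /norm I0 image_set0 sup0.
Qed.

Let ler_normD (a b : ellinf) : norm (a + b) <= norm a + norm b.
Proof.
apply: norm_le => [|i]; first exact: addr_ge0.
by rewrite (le_trans (ler_normD _ _)) // lerD.
Qed.

Let normrZ_le (c : R) (a : ellinf) : norm (c *: a) <= `|c| * norm a.
Proof.
apply: norm_le => [|i]; first exact: mulr_ge0.
by rewrite [leLHS]normrM ler_wpM2l.
Qed.

Let normrZ (c : R) (a : ellinf) : norm (c *: a) = `|c| * norm a.
Proof.
apply/eqP; rewrite eq_le normrZ_le /=.
have [->|c0] := eqVneq c 0; first by rewrite normr0 mul0r.
rewrite -ler_pdivlMl ?normr_gt0 // -normfV.
by rewrite -{1}[a](scalerK c0).
Qed.

Let normr0_eq0 (a : ellinf) : norm a = 0 -> a = 0.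
Proof.
move=> a0; apply: val_inj; apply/funext => i; apply/eqP.
by rewrite -normr_le0 -a0.
Qed.

HB.instance Definition _ :=
  Lmodule_isNormed.Build R ellinf ler_normD normrZ normr0_eq0.

Lemma ellinf_normE (b : ellinf) : `|b| = sup (range (fun i => `|b i|)).
Proof. by []. Qed.

Lemma ellinf_norm_ub (b : ellinf) i : `|b i| <= `|b|.
Proof. exact: norm_ub. Qed.

Lemma ellinf_norm_le (b : ellinf) (M : R) : 0 <= M ->
  (forall i, `|b i| <= M) -> `|b| <= M.
Proof. exact: norm_le. Qed.

Lemma ellinf_indic_subproof (B : set I) : (\1_B : I -> R) \in ellinf_pred.
Proof.
apply/ellinf_predP; exists 1 => i.
by rewrite indicE; case: (i \in B); rewrite ?normr1 ?normr0.
Qed.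

Definition ellinf_indic (B : set I) : ellinf := Ellinf (ellinf_indic_subproof B).

End ellinf.

Section operators.
Context {R : realType} {V W : normedModType R}.

Definition lspan (A : set V) : set V :=
  [set x | exists n (c : 'I_n -> R) (y : 'I_n -> V),
    (forall i, A (y i)) /\ x = \sum_(i < n) c i *: y i].

Definition bounded_operator (T : {linear V -> W}) : Prop :=
  exists M : R, forall x, `|T x| <= M * `|x|.

(* Extended-real valued, so that it is +oo when T is unbounded. *)
Definition opnorm (T : {linear V -> W}) : \bar R :=
  ereal_sup [set `|T x|%:E | x in [set x : V | `|x| <= 1]].

End operators.

Section hankel.
Context (R : realType) (Sigma : finType).
Local Notation word := (seq Sigma).
Implicit Type L : set word.

Definition lquot (u : word) L : set word := [set v | L (u ++ v)].

Definition hankel_space L : set (ellinf R word) :=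
  closure (lspan (range (fun u => ellinf_indic R (lquot u L)))).

Definition hankel_fun L (a : ell1 R word) (v : word) : R :=
  rsum (fun u => a u * \1_L (u ++ v)).

Lemma hankel_term_le L (a : ell1 R word) v u :
  `|a u * \1_L (u ++ v)| <= `|a u|.
Proof.
by rewrite indicE; case: (_ \in L); rewrite ?mulr1 // mulr0 normr0.
Qed.

Lemma hankel_summable L (a : ell1 R word) v :
  summable_family (fun u => a u * \1_L (u ++ v)).
Proof. apply: summable_family_le (ell1P a) => u; exact: hankel_term_le. Qed.

Lemma hankel_fun_subproof L (a : ell1 R word) :
  hankel_fun L a \in @ellinf_pred R word.
Proof.
apply/ellinf_predP; exists (l1norm a) => v.
apply: le_trans (rsum_le (hankel_summable L a v)) _.
by apply: l1norm_le (ell1P a) => u; exact: hankel_term_le.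
Qed.

Definition hankel L (a : ell1 R word) : ellinf R word :=
  Ellinf (hankel_fun_subproof L a).

Lemma hankel_linear L : linear (hankel L).
Proof.
move=> c a b; apply: val_inj; apply/funext => v /=.
transitivity (rsum (c *: (fun u => a u * \1_L (u ++ v)) +
                    (fun u => b u * \1_L (u ++ v)))).
  by congr rsum; apply/funext => u; rewrite [LHS]mulrDl -mulrA.
have sa := hankel_summable L a v; have sb := hankel_summable L b v.
by rewrite (rsumD (summable_familyZ c sa) sb) (rsumZ c sa).
Qed.

HB.instance Definition _ L :=
  GRing.isLinear.Build R (ell1 R word) (ellinf R word) *:%R (hankel L)
    (hankel_linear L).

End hankel.

Arguments hankel R {Sigma} L a.
Arguments hankel_space R {Sigma} L.

(* Main.v *)
Require Import Defs.
From mathcomp Require Import all_boot all_order all_algebra.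
From mathcomp Require Import all_classical all_reals all_analysis.
From mathcomp Require Import lra.
Import Order.TTheory GRing.Theory Num.Theory.
Import numFieldNormedType.Exports.
Local Open Scope classical_set_scope.
Local Open Scope ring_scope.

(** Each row of the Hankel matrix has entries in {0, 1}, so that
    |sum_u a(u) 1_L(uv)| <= sum_u |a(u)| for every v: this gives boundedness and
    the bound 1 on the operator norm (hankel_norm_le). The series for a unit
    vector has a single nonzero term, whence H e_u = 1_{u^-1 L} (hankel_unit).

    For the range, a linear operator sends the span of the e_u onto the span of
    their images (image_lspan), that is, here, onto the span of the
    1_{u^-1 L}. This already gives one inclusion between the closures. For the
    other one, finitely supported families are dense in l_1
    (closure_lspan_ell1_unit), and a continuous map sends the closure of a set
    into the closure of its image; so ran H lies in X_L, which is closed. *)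

Lemma bounded_operator_continuous (R : realType) (V W : normedModType R)
  (T : {linear V -> W}) : bounded_operator T -> continuous T.
Proof.
move=> [M TM]; apply/bounded_linear_continuous/linear_boundedP.
near=> r => x; apply: (le_trans (TM x)).
by rewrite ler_wpM2r //; near: r; exact: nbhs_pinfty_ge.
Unshelve. all: by end_near. Qed.

Lemma continuous_image_closure (V W : topologicalType) (f : V -> W) (A : set V) :
  continuous f -> f @` closure A `<=` closure (f @` A).
Proof.
move=> cf _ [x Ax <-] B /cf/Ax [y [Ay By]].
by exists (f y); split => //; exists y.
Qed.

Lemma lspan_sum_seq (R : realType) (V : normedModType R) (I : Type)
    (r : seq I) (c : I -> R) (y : I -> V) (A : set V) :
  (forall i, A (y i)) -> lspan A (\sum_(i <- r) c i *: y i).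
Proof.
move=> Ay; exists (size r), (c \o tnth (in_tuple r)), (y \o tnth (in_tuple r)).
by split=> [i|]; [exact: Ay|rewrite big_tnth].
Qed.

Lemma image_lspan (R : realType) (V W : normedModType R) (T : {linear V -> W})
    (I : Type) (y : I -> V) :
  T @` lspan (range y) = lspan (range (T \o y)).
Proof.
apply/seteqP; split=> [_ [_ [n [c [z [yz ->]]]] <-]|x [n [c [z [yz ->]]]]].
  exists n, c, (T \o z); split=> [i|].
    by have [j _ yj] := yz i; exists j; rewrite //= yj.
  by rewrite linear_sum; apply: eq_bigr => i _; rewrite linearZ.
have {}yz i : exists j, T (y j) = z i by have [j _ yj] := yz i; exists j.
have [j jz] := choice yz.
exists (\sum_(i < n) c i *: y (j i)).
  by exists n, c, (y \o j); split => // i; exists (j i).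
by rewrite linear_sum; apply: eq_bigr => i _; rewrite linearZ /= jz.
Qed.

Lemma ell1_sum_unitE (R : realType) (I : choiceType) (r : seq I)
    (a : I -> R) (w : I) : uniq r ->
  (\sum_(u <- r) a u *: ell1_unit R u : ell1 R I) w =
  if w \in r then a w else 0.
Proof.
move=> ur.
have -> : (\sum_(u <- r) a u *: ell1_unit R u : ell1 R I) w =
          \sum_(u <- r) a u * \1_[set u] w.
  (* Evaluation at w is additive on l_1. *)
  by elim/big_ind2: _ => // x p y q <- <-.
under eq_bigr => u _ do rewrite indicE in_set1.
case: ifPn => [wr|wr].
  rewrite (bigD1_seq w) //= eqxx mulr1 big1 ?addr0 // => u uw.
  by rewrite eq_sym (negbTE uw) mulr0.
rewrite big_seq big1 // => u ur'; case: eqP => [wu|_]; last by rewrite mulr0.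
by rewrite wu ur' in wr.
Qed.

(** The norm of a is the supremum of the finite partial sums of |a|, so some
    finite r carries all of it up to e. The truncation s of a to r and the
    remainder a - s have disjoint supports, so their norms add up to that of a,
    and the remainder has norm less than e. *)
Lemma closure_lspan_ell1_unit (R : realType) (I : choiceType) (a : ell1 R I) :
  closure (lspan (range (ell1_unit R (I := I)))) a.
Proof.
move=> B /nbhs_normP[e /= e0 eB].
have /(ub_ereal_sup_adherent e0)[_ [A [finA _] <-]] :
    (\esum_(i in setT) (`|a i|%:E))%E \is a fin_num.
  by have := ell1P a; rewrite unfold_in /ell1_pred /summable_family summableE.
rewrite -/(esum setT (fun i => `|a i|%:E)) -(l1normE (ell1P a)) => aA.
have [r ur Ar] : exists2 r, uniq r & A = [set` r].
  have /finite_seqP[r ->] := finA; exists (undup r); first exact: undup_uniq.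
  by apply/seteqP; split=> i /=; rewrite mem_undup.
move: aA; rewrite Ar -fsbig_seq // sumEFin -EFinB lte_fin => aA.
pose s := \sum_(u <- r) a u *: ell1_unit R u : ell1 R I.
exists s; split; first by apply: lspan_sum_seq => i; exists i.
apply: eB => /=.
have sE w : s w = if w \in r then a w else 0 by exact: ell1_sum_unitE.
have aE : `|a| = `|a - s| + `|s|.
  rewrite -![`|_ : ell1 R I|]/(l1norm _).
  apply: EFin_inj; rewrite EFinD !l1normE ?ell1P //; try exact: ell1P.
  rewrite -esumD //; apply: eq_esum => i _.
  rewrite -EFinD; congr EFin.
  rewrite -[(a - s) i]/(a i - s i) sE.
  by case: ifP; rewrite ?subrr ?subr0 normr0 ?add0r ?addr0.
have sr : \sum_(u <- r) `|a u| <= `|s|.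
  rewrite -[`|s|]/(l1norm _) -lee_fin l1normE ?ell1P //; last exact: ell1P.
  apply: esum_ge; exists [set` r]; first by split => //; exact: finite_seq.
  rewrite -fsbig_seq // -sumEFin; rewrite !big_seq lee_sum // => i ir.
  by rewrite sE ir.
move: aA; rewrite -[l1norm _]/`|a| aE => aA; lra.
Qed.

Lemma l1norm_indic1 (R : realType) (I : choiceType) (u : I) :
  l1norm (\1_[set u] : I -> R) = 1.
Proof.
rewrite /l1norm (eq_esum (b := fun j => if j \in [set u] then 1%E else 0%E)).
  by rewrite -esum_mkcond esum_set1.
by move=> j _; rewrite indicE; case: (j \in _); rewrite ?normr1 ?normr0.
Qed.

(** The sum is defined through positive and negative parts; for an indicator
    the negative part vanishes, and the sum is the l_1 norm. *)
Lemma rsum_indic1 (R : realType) (I : choiceType) (u : I) :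
  rsum (\1_[set u] : I -> R) = 1.
Proof.
have s0 : summable_family (0 : I -> R).
  by have := summable_familyZ 0 (ell1P (ell1_unit R u)); rewrite scale0r.
rewrite (@rsum_posneg _ _ _ \1_[set u] 0) //.
- have := l1normZ 0 s0; rewrite scale0r normr0 mul0r => ->.
  by rewrite l1norm_indic1 subr0.
- exact: ell1P (ell1_unit R u).
- by rewrite subr0.
Qed.

Lemma hankel_norm_le (R : realType) (Sigma : finType) (L : set (seq Sigma))
  (a : ell1 R (seq Sigma)) : `|hankel R L a| <= `|a|.
Proof.
apply: ellinf_norm_le => // v.
apply: (le_trans (rsum_le (hankel_summable L a v))).
by apply: l1norm_le (ell1P a) => u; exact: hankel_term_le.
Qed.

Lemma hankel_unit (R : realType) (Sigma : finType) (L : set (seq Sigma))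
    (u : seq Sigma) :
  hankel R L (ell1_unit R u) = ellinf_indic R (lquot u L).
Proof.
apply: val_inj; apply/funext => v /=.
rewrite /hankel_fun.
(* As a function of w, only the term w = u survives. *)
have -> : (fun w => ell1_unit R u w * \1_L (w ++ v)) =
          (\1_L (u ++ v) : R) *: (\1_[set u] : _ -> R).
  apply/funext => w; rewrite -[RHS]/(\1_L (u ++ v) * \1_[set u] w) mulrC /=.
  rewrite !indicE in_set1.
  by case: eqP => [->|_] //; rewrite !mulr0.
rewrite rsumZ ?rsum_indic1 ?mulr1; last exact: ell1P (ell1_unit R u).
by rewrite !indicE; congr (_%:R); congr nat_of_bool; apply/idP/idP; rewrite !inE.
Qed.

Theorem proposition8p2 (R : realType) (Sigma : finType)
    (Sigma_gt0 : (0 < #|Sigma|)%N) (L : set (seq Sigma)) :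
  [/\ bounded_operator (hankel R L),
      (opnorm (hankel R L) <= 1)%E,
      (forall u : seq Sigma,
         hankel R L (ell1_unit R u) = ellinf_indic R (lquot u L)) &
      closure (range (hankel R L)) = hankel_space R L].
Proof.
have Hbnd : bounded_operator (hankel R L).
  by exists 1 => a; rewrite mul1r; exact: hankel_norm_le.
have spanE : hankel R L @` lspan (range (ell1_unit R (I := seq Sigma))) =
    lspan (range (fun u => ellinf_indic R (lquot u L))).
  rewrite image_lspan.
  have -> // : hankel R L \o ell1_unit R (I := _) =
      (fun u => ellinf_indic R (lquot u L)).
  by apply/funext => u; exact: hankel_unit.
split=> //.
- apply: ge_ereal_sup => _ [a /= a1 <-]; rewrite lee_fin.
  exact: le_trans (hankel_norm_le _ _ _ _) a1.
- exact: hankel_unit.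
rewrite /hankel_space -spanE; set S := lspan _; apply/seteqP; split.
  have /closure_id -> := @closed_closure _ (hankel R L @` S).
  apply: closureS => _ [a _ <-].
  have Hcont := bounded_operator_continuous _ _ _ _ Hbnd.
  apply: (continuous_image_closure _ _ _ S Hcont).
  by exists a => //; exact: closure_lspan_ell1_unit.
by apply: closureS => _ [a _ <-]; exists a.
Qed.
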